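(* Let $k$ be an infinite field, let $G$ be a connected graph on the vertices $x_1,\ldots,x_n$ containing an irreducible even closed walk, let $R=k[x_1,\ldots,x_n]_{(x_1,\ldots,x_n)}$ with maximal ideal $\mathfrak{m}$, and let $I=I(G)\subset R$ be the edge ideal of $G$. Then $\mathrm{core}(I)\subset \mathfrak{m}I$.
   Context: Graphs are finite and simple. The edge ideal $I(G)$ is the ideal of $R$ generated by all products $x_ix_j$ such that $\{x_i,x_j\}$ is an edge of $G$. A closed walk with consecutive edges $e_1,e_2,\ldots,e_d$ (edges may be repeated) is even if $d$ is even. An even closed walk is reducible if there exist positions $i,j$ of different parities with $e_i=e_j$; otherwise it is irreducible. A reduction of an ideal $I$ is an ideal $J\subset I$ with $I^{r+1}=JI^r$ for some integer $r\ge 0$ (equivalently, $\overline{J}=\overline{I}$, where the bar denotes integral closure). The core of $I$, $\mathrm{core}(I)$, is the intersection of all reductions of $I$; over a Noetherian local ring it equals the intersection of all minimal reductions (minimal with respect to inclusion). *)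

(* Defs.v *)
From HB Require Import structures.
From mathcomp Require Import all_boot all_order all_algebra.
From mathcomp Require Import boolp.
From mathcomp Require Import mpoly.

Set Implicit Arguments.
Unset Strict Implicit.
Unset Printing Implicit Defensive.

Import GRing.Theory.
Local Open Scope ring_scope.

Definition infinite_type (T : eqType) : Prop :=
  forall s : seq T, exists x, x \notin s.

(* Ideals are Prop-valued predicates, so that the intersection of an arbitrary
   family of ideals is again an ideal; they are compared extensionally. *)

Record is_ideal (A : comNzRingType) (I : A -> Prop) : Prop := IsIdeal {
  ideal0 : I 0;
  idealD : forall x y, I x -> I y -> I (x + y);
  idealMl : forall a x, I x -> I (a * x)
}.

Definition ideal_sub (A : comNzRingType) (I J : A -> Prop) : Prop :=
  forall x, I x -> J x.

Definition ideal_eq (A : comNzRingType) (I J : A -> Prop) : Prop :=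
  forall x, I x <-> J x.

Definition ideal_gen (A : comNzRingType) (S : A -> Prop) : A -> Prop :=
  fun x => forall J, is_ideal J -> (forall s, S s -> J s) -> J x.

Definition ideal_mul (A : comNzRingType) (I J : A -> Prop) : A -> Prop :=
  ideal_gen (fun z => exists x y, [/\ I x, J y & z = x * y]).

Definition ideal_exp (A : comNzRingType) (I : A -> Prop) (r : nat) : A -> Prop :=
  iter r (ideal_mul I) (fun=> True).

Definition reduction (A : comNzRingType) (I J : A -> Prop) : Prop :=
  [/\ is_ideal J, ideal_sub J I &
      exists r : nat, ideal_eq (ideal_exp I r.+1) (ideal_mul J (ideal_exp I r))].

Definition core (A : comNzRingType) (I : A -> Prop) : A -> Prop :=
  fun x => forall J, reduction I J -> J x.

Lemma ideal_gen_ideal (A : comNzRingType) (S : A -> Prop) :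
  is_ideal (ideal_gen S).
Proof.
split=> [J iJ _|x y Sx Sy J iJ SJ|a x Sx J iJ SJ]; first exact: ideal0.
  by apply: (idealD iJ); [apply: Sx | apply: Sy].
by apply: (idealMl iJ); apply: Sx.
Qed.

Lemma ideal_sum (A : comNzRingType) (I : A -> Prop) (T : Type) (r : seq T)
    (P : pred T) (F : T -> A) :
  is_ideal I -> (forall i, P i -> I (F i)) -> I (\sum_(i <- r | P i) F i).
Proof. by move=> iI IF; apply: big_ind => //; [apply: ideal0 | apply: idealD]. Qed.

Definition irrelevant (k : fieldType) (n : nat) : {mpoly k[n]} -> Prop :=
  ideal_gen (fun p => exists i : 'I_n, p = 'X_i).

Lemma irrelevantE (k : fieldType) (n : nat) (p : {mpoly k[n]}) :
  irrelevant p <-> p@_0%MM = 0.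
Proof.
split.
  move=> /(_ (fun q => q@_0%MM = 0)); apply; first split.
  - exact: mcoeff0.
  - by move=> x y x0 y0; rewrite mcoeffD x0 y0 addr0.
  - by move=> a x x0; rewrite rmorphM /= x0 mulr0.
  move=> _ [i ->]; rewrite mcoeffX; case: eqP => // /mnmP /(_ i).
  by rewrite mnm1E eqxx mnm0E.
move=> p0; rewrite [p]mpolyE big_seq_cond.
apply: ideal_sum => [|m]; first exact: ideal_gen_ideal.
rewrite andbT => m_p; have : m != 0%MM.
  by apply: contraTneq m_p => ->; rewrite mcoeff_msupp p0 eqxx.
rewrite -mdeg_eq0 mdegE sum_nat_eq0 negb_forall => /existsP[i /= mi].
have le_im : (U_(i) <= m)%MM by rewrite lep1mP.
rewrite -(submK le_im) mpolyXD scalerAl.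
apply: (idealMl (ideal_gen_ideal _)) => J _; apply; by exists i.
Qed.

Definition loc_pred (k : fieldType) (n : nat) : pred {fraction {mpoly k[n]}} :=
  fun f => `[< exists p q : {mpoly k[n]},
                 ~ irrelevant q /\ f = tofrac p / tofrac q >].

(* The localization of k[x_1, ..., x_n] at (x_1, ..., x_n), as a subring of the
   field of rational functions. *)
Record polyloc (k : fieldType) (n : nat) := PolyLoc {
  polyloc_val : {fraction {mpoly k[n]}};
  _ : polyloc_val \in @loc_pred k n
}.

Lemma irrelevantM (k : fieldType) (n : nat) (p q : {mpoly k[n]}) :
  ~ irrelevant p -> ~ irrelevant q -> ~ irrelevant (p * q).
Proof.
rewrite !irrelevantE => /eqP p0 /eqP q0; rewrite rmorphM /=.
by apply/eqP; rewrite mulf_neq0.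
Qed.

Lemma tofrac_irrelevant (k : fieldType) (n : nat) (q : {mpoly k[n]}) :
  ~ irrelevant q -> tofrac q != 0.
Proof.
move=> q0; rewrite tofrac_eq0; apply/eqP => qe; apply: q0.
by rewrite qe; apply: ideal0; apply: ideal_gen_ideal.
Qed.

Lemma loc_pred_poly (k : fieldType) (n : nat) (p : {mpoly k[n]}) :
  tofrac p \in @loc_pred k n.
Proof.
apply/asboolP; exists p, 1; split; last by rewrite tofrac1 divr1.
by rewrite irrelevantE mcoeff1 eqxx; apply/eqP; rewrite oner_neq0.
Qed.

Lemma loc_pred_subring (k : fieldType) (n : nat) :
  subring_closed (@loc_pred k n).
Proof.
split.
- by rewrite -tofrac1 loc_pred_poly.
- move=> _ _ /asboolP[p [q [q0 ->]]] /asboolP[p' [q' [q'0 ->]]].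
  apply/asboolP; exists (p * q' - p' * q), (q * q').
  split; first exact: irrelevantM.
  rewrite -mulNr addf_div ?tofrac_irrelevant //.
  by rewrite mulNr tofracB !tofracM.
- move=> _ _ /asboolP[p [q [q0 ->]]] /asboolP[p' [q' [q'0 ->]]].
  apply/asboolP; exists (p * p'), (q * q').
  split; first exact: irrelevantM.
  by rewrite mulf_div !tofracM.
Qed.

HB.instance Definition _ (k : fieldType) (n : nat) :=
  GRing.isSubringClosed.Build {fraction {mpoly k[n]}} (@loc_pred k n)
    (@loc_pred_subring k n).

HB.instance Definition _ (k : fieldType) (n : nat) :=
  [isSub for @polyloc_val k n].
HB.instance Definition _ (k : fieldType) (n : nat) :=
  [Choice of polyloc k n by <:].
HB.instance Definition _ (k : fieldType) (n : nat) :=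
  [SubChoice_isSubComNzRing of polyloc k n by <:].

Definition to_polyloc (k : fieldType) (n : nat) (p : {mpoly k[n]}) :
  polyloc k n := PolyLoc (loc_pred_poly p).

Definition locX (k : fieldType) (n : nat) (i : 'I_n) : polyloc k n :=
  to_polyloc 'X_i.

Definition max_ideal (k : fieldType) (n : nat) : polyloc k n -> Prop :=
  ideal_gen (fun f => exists i : 'I_n, f = locX k i).

Lemma max_idealE (k : fieldType) (n : nat) (f : polyloc k n) :
  max_ideal f <-> ~ (exists g, f * g = 1).
Proof.
have valM (a b : polyloc k n) :
  polyloc_val (a * b) = polyloc_val a * polyloc_val b by exact: (rmorphM val).
have valD (a b : polyloc k n) :
  polyloc_val (a + b) = polyloc_val a + polyloc_val b by exact: (rmorphD val).
have val1 : polyloc_val (1 : polyloc k n) = 1 by exact: (rmorph1 val).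
have val0 : polyloc_val (0 : polyloc k n) = 0 by exact: (rmorph0 val).
have val_eq (a b : polyloc k n) : polyloc_val a = polyloc_val b -> a = b.
  exact: val_inj.
split.
  pose N (g : polyloc k n) := exists p q : {mpoly k[n]},
    [/\ irrelevant p, ~ irrelevant q & polyloc_val g = tofrac p / tofrac q].
  have nz1 : ~ irrelevant (1 : {mpoly k[n]}).
    by rewrite irrelevantE mcoeff1 eqxx; apply/eqP; rewrite oner_neq0.
  have iirr := ideal_gen_ideal (fun p : {mpoly k[n]} => exists i, p = 'X_i).
  have iN : is_ideal N.
    split.
    - exists 0, 1; split=> //; first exact: (ideal0 iirr).
      by rewrite tofrac0 mul0r.
    - move=> x y [p [q [p0 q0 xE]]] [p' [q' [p'0 q'0 yE]]].
      exists (q' * p + q * p'), (q * q'); split.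
      + by apply: (idealD iirr); apply: (idealMl iirr).
      + exact: irrelevantM.
      rewrite valD xE yE addf_div ?tofrac_irrelevant // tofracD !tofracM.
      by rewrite [tofrac q' * _]mulrC [tofrac q * tofrac p']mulrC.
    - move=> [a aP] x [p [q [p0 q0 xE]]].
      have /asboolP[p' [q' [q'0 aE]]] := aP.
      exists (p' * p), (q' * q); split.
      + exact: (idealMl iirr).
      + exact: irrelevantM.
      by rewrite valM xE /= aE mulf_div !tofracM.
  move=> /(_ N iN) Nf [g fg].
  have {Nf} [j|p [q [p0 q0 fE]]] := Nf.
    move=> [i ->]; exists 'X_i, 1; split=> //; last by rewrite tofrac1 divr1.
    by move=> J _; apply; exists i.
  have /asboolP[p' [q' [q'0 gE]]] : polyloc_val g \in @loc_pred k n by case: (g).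
  have := congr1 (@polyloc_val k n) fg; rewrite valM val1 fE gE mulf_div.
  move=> /(canRL (divfK _)); rewrite mulf_neq0 ?tofrac_irrelevant // mul1r.
  move=> /(_ isT) /eqP; rewrite -!tofracM tofrac_eq => /eqP e.
  apply: (irrelevantM q0 q'0); rewrite -e mulrC; exact: (idealMl iirr).
case: f => f fP nu.
have /asboolP[p [q [q0 fE]]] := fP.
have qP : (tofrac q)^-1 \in @loc_pred k n.
  by apply/asboolP; exists 1, q; split; rewrite // tofrac1 mul1r.
have p0 : irrelevant p.
  apply: contrapT => p0; apply: nu.
  have gP : tofrac q / tofrac p \in @loc_pred k n by apply/asboolP; exists q, p.
  exists (PolyLoc gP); apply: val_eq; rewrite valM val1 /= fE.
  by rewrite -invf_div mulVf // mulf_neq0 ?invr_eq0 ?tofrac_irrelevant.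
have -> : PolyLoc fP = PolyLoc qP * to_polyloc p.
  by apply: val_eq; rewrite valM /= fE mulrC.
apply: (idealMl (ideal_gen_ideal _)) => J iJ XJ.
apply: (p0 (fun r => J (to_polyloc r))) => [|_ [i ->]]; last by apply: XJ; exists i.
split.
- have -> : to_polyloc (0 : {mpoly k[n]}) = 0 :> polyloc k n.
    by apply: val_eq; rewrite val0 /= tofrac0.
  exact: ideal0.
- move=> x y Jx Jy; have -> : to_polyloc (x + y) = to_polyloc x + to_polyloc y.
    by apply: val_eq; rewrite valD /= tofracD.
  exact: idealD.
- move=> a x Jx; have -> : to_polyloc (a * x) = to_polyloc a * to_polyloc x.
    by apply: val_eq; rewrite valM /= tofracM.
  exact: idealMl.
Qed.

Definition edge_ideal (k : fieldType) (n : nat) (e : rel 'I_n) :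
  polyloc k n -> Prop :=
  ideal_gen (fun f => exists i j : 'I_n, e i j /\ f = locX k i * locX k j).

Arguments max_ideal k n : clear implicits.
Arguments edge_ideal k [n] e.

Definition simple_graph (T : finType) (e : rel T) : Prop :=
  ssrbool.symmetric e /\ irreflexive e.

Definition connected_graph (T : finType) (e : rel T) : Prop :=
  (0 < #|T|)%N /\ forall u v : T, connect e u v.

(* A closed walk w_0, w_1, ..., w_d = w_0 is given by the sequence
   [:: w_0; ...; w_(d-1)]; it has as many edges as this sequence has items. *)
Definition closed_walk (T : finType) (e : rel T) (w : seq T) : Prop :=
  (0 < size w)%N /\ cycle e w.

Definition walk_edges (T : finType) (w : seq T) : seq {set T} :=
  [seq [set uv.1; uv.2] | uv <- zip w (rot 1 w)].

Definition even_closed_walk (T : finType) (e : rel T) (w : seq T) : Prop :=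
  closed_walk e w /\ ~~ odd (size (walk_edges w)).

Definition reducible_walk (T : finType) (w : seq T) : Prop :=
  exists i j : nat,
    [/\ (i < size (walk_edges w))%N, (j < size (walk_edges w))%N,
        odd i != odd j &
        nth set0 (walk_edges w) i = nth set0 (walk_edges w) j].

(* Main.v *)
(** The generators of [I / m I] are the edges, and the even and odd edges of an
    irreducible even closed walk form two disjoint families [xs], [ys] of [s]
    edges with the same product.  If [f] in [I] is not in [m I], then some edge
    [m0] occurs in [f] with a nonzero residue; by symmetry [m0] is not in [ys].
    Choose weights [a] on the edges that vanish exactly on [ys], with
    [a m0 = 1], such that the linear form [a] does not kill the class of [f] in
    [I / m I].  The ideal [J] generated by all [m - a m * m0] lies in the kernel
    of that form, hence misses [f].  It is a reduction: modulo [J I^(s-1)] each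
    product of [s] edges is the product of their weights times [m0^s], and
    comparing [xs] with [ys] shows that [m0^s] itself vanishes. *)

Require Import Defs.
From HB Require Import structures.
From mathcomp Require Import all_boot all_order all_algebra.
From mathcomp Require Import boolp.
From mathcomp Require Import mpoly ring.

Set Implicit Arguments.
Unset Strict Implicit.
Unset Printing Implicit Defensive.

Import GRing.Theory.
Local Open Scope ring_scope.

(** * Products of ideals and a criterion for reductions *)

Section IdealProducts.

Variable A : comNzRingType.
Implicit Types (I J K : A -> Prop) (S : A -> Prop).

Lemma ideal_gen_mem S x : S x -> ideal_gen S x.
Proof. by move=> Sx J _; apply. Qed.

Lemma ideal_gen_sub S J :
  is_ideal J -> (forall x, S x -> J x) -> ideal_sub (ideal_gen S) J.
Proof. by move=> iJ SJ x; apply. Qed.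

Lemma idealN I x : is_ideal I -> I x -> I (- x).
Proof. by move=> iI Ix; rewrite -mulN1r; apply: (idealMl iI). Qed.

Lemma ideal_mul_ideal I J : is_ideal (ideal_mul I J).
Proof. exact: ideal_gen_ideal. Qed.

Lemma ideal_mul_mem I J x y : I x -> J y -> ideal_mul I J (x * y).
Proof. by move=> Ix Jy; apply: ideal_gen_mem; exists x, y. Qed.

Lemma ideal_mulS I I' J :
  ideal_sub I I' -> ideal_sub (ideal_mul I J) (ideal_mul I' J).
Proof.
move=> sII'; apply: ideal_gen_sub => [|_ [x [y [Ix Jy ->]]]].
  exact: ideal_mul_ideal.
by apply: ideal_mul_mem => //; apply: sII'.
Qed.

Lemma ideal_exp_mulS I J r z x :
  I z -> ideal_mul J (ideal_exp I r) x ->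
  ideal_mul J (ideal_exp I r.+1) (z * x).
Proof.
move=> Iz Jx; pose K y := ideal_mul J (ideal_exp I r.+1) (z * y).
apply: (Jx K) => [|_ [u [v [Ju Iv ->]]]]; last first.
  by rewrite /K mulrCA; apply: ideal_mul_mem => //; apply: ideal_mul_mem.
have iJ := ideal_mul_ideal J (ideal_exp I r.+1).
split=> [|u v Ku Kv|c u Ku]; rewrite /K.
- by rewrite mulr0; apply: (ideal0 iJ).
- by rewrite mulrDr; apply: (idealD iJ).
- by rewrite mulrCA; apply: (idealMl iJ).
Qed.

Lemma reduction_refl I : is_ideal I -> reduction I I.
Proof. by move=> iI; split=> //; exists 0. Qed.

Variables (T : eqType) (P : pred T) (X : T -> A).

Definition family_ideal : A -> Prop :=
  ideal_gen (fun f => exists2 t, P t & f = X t).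

Lemma prod_family_exp (ts : seq T) :
  all P ts -> ideal_exp family_ideal (size ts) (\prod_(t <- ts) X t).
Proof.
elim: ts => [//|t ts IH] /= /andP[Pt Pts]; rewrite big_cons; apply: ideal_mul_mem.
  by apply: ideal_gen_mem; exists t.
exact: IH.
Qed.

(** Reduces an inclusion out of a power of the ideal to a check on products of [r] generators. *)
Lemma family_exp_gen r :
  ideal_sub (ideal_exp family_ideal r)
    (ideal_gen (fun f => exists ts, [/\ size ts = r, all P ts
       & f = \prod_(t <- ts) X t])).
Proof.
elim: r => [|r IH].
  move=> x _; rewrite -[x]mulr1; apply: (idealMl (ideal_gen_ideal _)).
  by apply: ideal_gen_mem; exists [::]; rewrite big_nil.
set K := ideal_gen _; have iK : is_ideal K by exact: ideal_gen_ideal.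
apply: ideal_gen_sub => // _ [x [y [Ix /IH Iy ->]]] {IH}.
have iL u : is_ideal (fun v => K (u * v)).
  split=> [|v v' Kv Kv'|c v Kv]; first by rewrite mulr0; apply: (ideal0 iK).
    by rewrite mulrDr; apply: (idealD iK).
  by rewrite mulrCA; apply: (idealMl iK).
have iR u : is_ideal (fun v => K (v * u)).
  have [K0 KD KM] := iL u; split=> [|v v' Kv Kv'|c v Kv].
  - by rewrite mulrC.
  - by rewrite mulrC; apply: KD; rewrite mulrC.
  - by rewrite mulrC; apply: KM; rewrite mulrC.
apply: (Iy (fun v => K (x * v))) => // _ [ts [sz Pts ->]].
apply: (Ix (fun v => K (v * _))) => // _ [t Pt ->].
by apply: ideal_gen_mem; exists (t :: ts); rewrite /= sz Pt big_cons.
Qed.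

Variables (t0 : T) (a : T -> A).

Definition pencil_ideal : A -> Prop :=
  ideal_gen (fun f => exists2 t, P t & f = X t - a t * X t0).

Hypothesis Pt0 : P t0.

(** Telescoping: the factors [X u] are traded one at a time for [a u * X t0], each trade costing an
    element of the pencil times a product of [size ts] generators. *)
Lemma prod_family_pencil t ts :
  all P (t :: ts) ->
  ideal_mul pencil_ideal (ideal_exp family_ideal (size ts))
    (\prod_(u <- t :: ts) X u
     - (\prod_(u <- t :: ts) a u) * X t0 ^+ (size ts).+1).
Proof.
elim: ts t => [|u ts IH] t /= /andP[Pt Pts].
  rewrite !big_seq1 expr1 -[X in ideal_mul _ _ X]mulr1; apply: ideal_mul_mem => //.
  by apply: ideal_gen_mem; exists t.
rewrite big_cons [\prod_(_ <- t :: _) a _]big_cons exprS.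
set p := \prod_(_ <- _) X _; set q := \prod_(_ <- _) a _.
set z := X t0 ^+ _.
(* The first summand trades the head factor; in the second, [X t0] raises by one the power of the
   family ideal given by induction. *)
have -> : X t * p - a t * q * (X t0 * z)
  = (X t - a t * X t0) * p + a t * (X t0 * (p - q * z)) by ring.
apply: (idealD (ideal_mul_ideal _ _)).
  apply: ideal_mul_mem; first by apply: ideal_gen_mem; exists t.
  exact: (@prod_family_exp (u :: ts)).
apply: (idealMl (ideal_mul_ideal _ _)); apply: ideal_exp_mulS.
  by apply: ideal_gen_mem; exists t0.
exact: IH.
Qed.

(** The common product is congruent both to a unit times [X t0 ^+ r.+1], through [xs], and to [0],
    through [ys]. This puts [X t0 ^+ r.+1], and with it every product of [r.+1] generators, in the
    product ideal. *)
Lemma pencil_reduction (r : nat) (xs ys : seq T) (b : A) :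
  size xs = r.+1 -> size ys = r.+1 ->
  all P xs -> all P ys ->
  \prod_(t <- xs) X t = \prod_(t <- ys) X t ->
  b * \prod_(t <- xs) a t = 1 -> \prod_(t <- ys) a t = 0 ->
  reduction family_ideal pencil_ideal.
Proof.
move=> sx sy Px Py eX ax ay.
have iI : is_ideal family_ideal by exact: ideal_gen_ideal.
have sJI : ideal_sub pencil_ideal family_ideal.
  apply: ideal_gen_sub => // _ [t Pt ->]; apply: (idealD iI).
    by apply: ideal_gen_mem; exists t.
  by apply: (idealN iI); apply: (idealMl iI); apply: ideal_gen_mem; exists t0.
split=> //; first exact: ideal_gen_ideal.
exists r; set K := ideal_mul _ _; have iK : is_ideal K by exact: ideal_mul_ideal.
have cong ts : size ts = r.+1 -> all P ts ->
    K (\prod_(u <- ts) X u - (\prod_(u <- ts) a u) * X t0 ^+ r.+1).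
  case: ts => // t ts [sz] Pts.
  by have := prod_family_pencil Pts; rewrite sz.
have Kz : K (X t0 ^+ r.+1).
  have Kx := cong xs sx Px; have := cong ys sy Py.
  rewrite ay mul0r subr0 -eX => KX.
  rewrite -[_ ^+ _]mul1r -ax -mulrA; apply: (idealMl iK).
  rewrite -[X in K X](subKr (\prod_(t <- xs) X t)).
  by apply: (idealD iK) => //; apply: (idealN iK).
move=> x; split; last exact: ideal_mulS.
move=> /family_exp_gen; apply: ideal_gen_sub => // _ [ts [sz Pts ->]].
rewrite -[X in K X](subrK ((\prod_(u <- ts) a u) * X t0 ^+ r.+1)).
by apply: (idealD iK) => //; [apply: cong | apply: (idealMl iK)].
Qed.

End IdealProducts.

(** * Fractions and lowest-degree coefficients *)

Section LocalRing.

Variables (k : fieldType) (n : nat).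

Lemma to_polyloc_zmod : zmod_morphism (@to_polyloc k n).
Proof.
move=> p q; apply: val_inj; rewrite (rmorphB val) /=.
exact: tofracB.
Qed.

Lemma to_polyloc_monoid : monoid_morphism (@to_polyloc k n).
Proof.
split=> [|p q]; apply: val_inj.
  by rewrite (rmorph1 val) /= tofrac1.
by rewrite (rmorphM val) /= tofracM.
Qed.

HB.instance Definition _ :=
  GRing.isZmodMorphism.Build _ _ (@to_polyloc k n) to_polyloc_zmod.
HB.instance Definition _ :=
  GRing.isMonoidMorphism.Build _ _ (@to_polyloc k n) to_polyloc_monoid.

Lemma to_polyloc_inj : injective (@to_polyloc k n).
Proof.
by move=> p q /(congr1 (@polyloc_val k n)) /eqP; rewrite /= tofrac_eq => /eqP.
Qed.

Lemma to_polyloc_unit (q : {mpoly k[n]}) :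
  q@_0%MM != 0 -> exists g, g * to_polyloc q = 1.
Proof.
move=> q0; have nq : ~ irrelevant q by rewrite irrelevantE; apply/eqP.
have qP : (tofrac q)^-1 \in @loc_pred k n.
  by apply/asboolP; exists 1, q; split; rewrite // tofrac1 mul1r.
exists (PolyLoc qP); apply: val_inj; rewrite (rmorph1 val) (rmorphM val) /=.
by rewrite mulVf ?tofrac_irrelevant.
Qed.

Lemma polyloc_den (f : polyloc k n) :
  exists p q : {mpoly k[n]}, q@_0%MM != 0 /\ to_polyloc q * f = to_polyloc p.
Proof.
have /asboolP[p [q [q0 fE]]] : polyloc_val f \in @loc_pred k n by case: f.
exists p, q; split; first by apply/eqP; rewrite -irrelevantE.
by apply: val_inj; rewrite (rmorphM val) /= fE mulrC divfK ?tofrac_irrelevant.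
Qed.

Lemma max_ideal_monomial (m : 'X_{1..n}) :
  m != 0%MM -> max_ideal k n (to_polyloc 'X_[m]).
Proof.
rewrite -mdeg_eq0 mdegE sum_nat_eq0 negb_forall => /existsP[i /= mi].
have le_im : (U_(i) <= m)%MM by rewrite lep1mP.
rewrite -(submK le_im) mpolyXD rmorphM; apply: (idealMl (ideal_gen_ideal _)).
by apply: ideal_gen_mem; exists i.
Qed.

(** Without its constant term, [g] multiplies [p] into degrees above [d]. *)
Lemma mcoeffM_low (d : nat) (g p : {mpoly k[n]}) (m : 'X_{1..n}) :
  (forall m', m' \in msupp p -> (d <= mdeg m')%N) -> mdeg m = d ->
  (g * p)@_m = g@_0%MM * p@_m.
Proof.
move=> p_low m_d; rewrite -{1}(subrK (g@_0%MM)%:MP g) mulrDl mcoeffD mcoeffCM.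
rewrite [X in X + _]memN_msupp_eq0 ?add0r //.
apply/negP => /msuppM_le /allpairsP[[m1 m2] /= [g_m1 /p_low d_m2 m_def]].
have : mdeg m1 != 0%N.
  rewrite mdeg_eq0; apply: contraTneq g_m1 => ->.
  by rewrite mcoeff_msupp mcoeffB mcoeffC eqxx mulr1 subrr eqxx.
rewrite -lt0n => m1_gt0; move: m_d; rewrite m_def mdegD => m_d.
by move: d_m2; rewrite -m_d leqNgt -[X in (X < _)%N]add0n ltn_add2r m1_gt0.
Qed.

(** * Linear forms on the edge ideal modulo the maximal ideal *)

Variable e : rel 'I_n.

(** Both orientations of an edge give the same monomial; [undup] makes sums over edges count it
    once. *)
Definition edge_mnms : seq 'X_{1..n} :=
  undup [seq (U_(ij.1) + U_(ij.2))%MM | ij in [pred ij : 'I_n * 'I_n | e ij.1 ij.2]].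

Lemma edge_mnmsP (m : 'X_{1..n}) :
  reflect (exists i j, e i j /\ m = (U_(i) + U_(j))%MM) (m \in edge_mnms).
Proof.
rewrite mem_undup; apply: (iffP imageP) => [[[i j] eij ->]|[i [j [eij ->]]]].
  by exists i, j.
by exists (i, j).
Qed.

Lemma mdeg_edge_mnms m : m \in edge_mnms -> mdeg m = 2%N.
Proof. by case/edge_mnmsP=> i [j [_ ->]]; rewrite mdegD !mdeg1. Qed.

Lemma edge_idealE : edge_ideal k e
  = family_ideal (fun m => m \in edge_mnms) (fun m => to_polyloc 'X_[m]).
Proof.
rewrite /edge_ideal /family_ideal; congr ideal_gen; apply/funext => f.
apply/propext; split=> [[i [j [eij ->]]]|[m /edge_mnmsP[i [j [eij ->]]] ->]].
  exists (U_(i) + U_(j))%MM; first by apply/edge_mnmsP; exists i, j.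
  by rewrite mpolyXD rmorphM.
by exists i, j; rewrite mpolyXD rmorphM.
Qed.

(** Membership in the edge ideal of the polynomial ring, a monomial ideal, read off the support. *)
Definition edge_supp (p : {mpoly k[n]}) : Prop :=
  forall m, m \in msupp p -> exists2 m', m' \in edge_mnms & (m' <= m)%MM.

Lemma edge_supp0 : edge_supp 0.
Proof. by move=> m; rewrite msupp0. Qed.

Lemma edge_suppD p q : edge_supp p -> edge_supp q -> edge_supp (p + q).
Proof.
by move=> sp sq m /msuppD_le; rewrite mem_cat => /orP[/sp|/sq].
Qed.

Lemma edge_suppM g p : edge_supp p -> edge_supp (g * p).
Proof.
move=> sp m /msuppM_le /allpairsP[[m1 m2] /= [_ /sp[m' em' m'm2] ->]].
exists m' => //; apply: (lepm_trans m'm2); exact: lem_addl.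
Qed.

Lemma edge_suppX m : m \in edge_mnms -> edge_supp 'X_[m].
Proof. by move=> em m'; rewrite msuppX inE => /eqP->; exists m; rewrite ?lepm_refl. Qed.

Definition edge_form (a : 'X_{1..n} -> k) (p : {mpoly k[n]}) : k :=
  \sum_(m <- edge_mnms) a m * p@_m.

Lemma edge_formD a p q : edge_form a (p + q) = edge_form a p + edge_form a q.
Proof.
by rewrite -big_split; apply: eq_bigr => m _; rewrite mcoeffD mulrDr.
Qed.

(** Edges have the least degree possible in [p], so only the constant term of [g] matters. Hence
    denominators merely rescale the form by nonzero constants. *)
Lemma edge_formM a g p :
  edge_supp p -> edge_form a (g * p) = g@_0%MM * edge_form a p.
Proof.
move=> sp; rewrite /edge_form mulr_sumr big_seq [RHS]big_seq.
apply: eq_bigr => m em; rewrite (@mcoeffM_low 2%N) ?mdeg_edge_mnms //.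
  by rewrite mulrCA.
move=> m' /sp[m1 /mdeg_edge_mnms <- m1m'].
by rewrite -(submK m1m') mdegD leq_addl.
Qed.

Lemma edge_formX a m : m \in edge_mnms -> edge_form a 'X_[m] = a m.
Proof.
move=> em; rewrite /edge_form (bigD1_seq m) ?undup_uniq //= mcoeffX eqxx mulr1.
rewrite big1 ?addr0 // => m' m'm; rewrite mcoeffX eq_sym (negbTE m'm).
by rewrite mulr0.
Qed.

(* The elements of the edge ideal whose class in [I / m I], with the edges as
   basis, is annihilated by the linear form with coefficients [a]. *)
Definition edge_annihilator (a : 'X_{1..n} -> k) (f : polyloc k n) : Prop :=
  exists p q : {mpoly k[n]},
    [/\ q@_0%MM != 0, to_polyloc q * f = to_polyloc p, edge_supp p
      & edge_form a p = 0].

Lemma edge_annihilator_poly a p :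
  edge_supp p -> edge_form a p = 0 -> edge_annihilator a (to_polyloc p).
Proof.
by move=> sp ap; exists p, 1; rewrite mcoeff1 eqxx oner_neq0 rmorph1 mul1r.
Qed.

Lemma edge_annihilator_ideal a : is_ideal (edge_annihilator a).
Proof.
split.
- rewrite -(rmorph0 (@to_polyloc k n)); apply: edge_annihilator_poly.
    exact: edge_supp0.
  by rewrite /edge_form big1 // => m _; rewrite mcoeff0 mulr0.
- move=> x y [p [q [q0 qx sp ap]]] [p' [q' [q'0 q'y sp' ap']]].
  exists (q' * p + q * p'), (q * q'); split.
  + by rewrite rmorphM mulf_neq0.
  + by rewrite rmorphD !rmorphM /= -qx -q'y; ring.
  + by apply: edge_suppD; apply: edge_suppM.
  + by rewrite edge_formD !edge_formM // ap ap' !mulr0 addr0.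
- move=> g x [p [q [q0 qx sp ap]]]; have [p' [q' [q'0 q'g]]] := polyloc_den g.
  exists (p' * p), (q' * q); split.
  + by rewrite rmorphM mulf_neq0.
  + by rewrite !rmorphM /= -qx -q'g; ring.
  + exact: edge_suppM.
  + by rewrite edge_formM // ap mulr0.
Qed.

(** Independence of the chosen fraction: cross-multiply two representations and compare forms, the
    constant terms of the denominators being nonzero. *)
Lemma edge_annihilator_form a f (p q : {mpoly k[n]}) :
  q@_0%MM != 0 -> to_polyloc q * f = to_polyloc p -> edge_supp p ->
  edge_annihilator a f -> edge_form a p = 0.
Proof.
move=> q0 qf sp [p' [q' [q'0 q'f sp' ap']]].
have epp : q' * p = q * p'.
  by apply: to_polyloc_inj; rewrite !rmorphM /= -qf -q'f mulrCA.
have := edge_formM a q' sp; rewrite epp edge_formM // ap' mulr0.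
by move=> /esym/eqP; rewrite mulf_eq0 (negbTE q'0) => /eqP.
Qed.

Lemma edge_ideal_den f : edge_ideal k e f ->
  exists p q : {mpoly k[n]},
    [/\ q@_0%MM != 0, to_polyloc q * f = to_polyloc p & edge_supp p].
Proof.
rewrite edge_idealE => If.
(* For the zero form, the annihilator only asks for a fraction with numerator supported on multiples
   of edges. *)
have [p [q [q0 qf sp _]]] : edge_annihilator (fun=> 0) f.
  apply: If; first exact: edge_annihilator_ideal.
  move=> _ [m em ->]; apply: edge_annihilator_poly; first exact: edge_suppX.
  by rewrite edge_formX.
by exists p, q.
Qed.

(** Each monomial of [p] is a multiple of an edge but not an edge itself, so its cofactor is a
    nonconstant monomial. *)
Lemma max_edge_ideal_poly (p : {mpoly k[n]}) :
  edge_supp p -> (forall m, m \in edge_mnms -> p@_m = 0) ->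
  ideal_mul (max_ideal k n) (edge_ideal k e) (to_polyloc p).
Proof.
move=> sp p0; rewrite [p]mpolyE rmorph_sum big_seq.
apply: ideal_sum => [|m m_p]; first exact: ideal_mul_ideal.
have [m' em' m'm] := sp m m_p.
rewrite -mul_mpolyC rmorphM; apply: (idealMl (ideal_mul_ideal _ _)).
rewrite -(submK m'm) mpolyXD rmorphM; apply: ideal_mul_mem.
  apply: max_ideal_monomial; apply: contraTneq m_p => m0.
  by rewrite mcoeff_msupp -(submK m'm) m0 add0m p0 ?eqxx.
by rewrite edge_idealE; apply: ideal_gen_mem; exists m'.
Qed.

End LocalRing.

(** * Choice of weights over an infinite field *)

Lemma generic_weight (k : fieldType) (T : eqType) (s ys : seq T) (t0 : T)
    (c : T -> k) :
  infinite_type k -> uniq s -> t0 \in s -> t0 \notin ys -> c t0 != 0 ->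
  exists a : T -> k,
    [/\ a t0 = 1, forall t, (a t == 0) = (t \in ys) &
        \sum_(t <- s) a t * c t != 0].
Proof.
move=> k_inf us st0 yt0 ct0.
(* With weight [0] on [ys], [1] at [t0] and [u] elsewhere, the sum is [c t0 + u * D]. So [u] must
   avoid [0] and the root of this polynomial; if [D = 0], the sum is [c t0] for every [u]. *)
pose D := \sum_(t <- s | (t != t0) && (t \notin ys)) c t.
have [u] := k_inf [:: 0; - c t0 / D]; rewrite !inE negb_or => /andP[u0 uD].
exists (fun t => if t \in ys then 0 else if t == t0 then 1 else u); split.
- by rewrite (negbTE yt0) eqxx.
- move=> t; case: (t \in ys); first by rewrite eqxx.
  by case: ifP => _; rewrite ?oner_eq0 ?(negbTE u0).
rewrite (bigD1_seq t0) //= (negbTE yt0) eqxx mul1r.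
have -> : \sum_(t <- s | t != t0)
    (if t \in ys then 0 else if t == t0 then 1 else u) * c t = u * D.
  rewrite mulr_sumr [RHS]big_mkcondr; apply: eq_bigr => t /negbTE->.
  by case: (t \in ys) => //=; rewrite mul0r.
have [D0|D0] := eqVneq D 0; first by rewrite D0 mulr0 addr0.
apply: contra uD => /eqP/(canRL (addKr _)); rewrite addr0 => <-.
by rewrite mulfK.
Qed.

(** * The binomial relation of an irreducible even closed walk *)

Section Walks.

Variables (n : nat) (e : rel 'I_n).

Lemma mnm_edge_set (u v u' v' : 'I_n) :
  (U_(u) + U_(v))%MM = (U_(u') + U_(v'))%MM -> [set u; v] = [set u'; v'].
Proof.
move=> /mnmP eq_uv; apply/setP => i; move: (eq_uv i); rewrite !mnmE !inE.
rewrite ![i == _]eq_sym.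
by do 4![case: (_ == i)].
Qed.

(** [xs] and [ys] are the edges at even and at odd positions. Every visit to a vertex ends one edge
    and starts the next, of opposite parity, so the products agree; a common edge would reduce the
    walk. *)
Lemma walk_binomial (w : seq 'I_n) :
  even_closed_walk e w -> ~ reducible_walk w ->
  exists r (xs ys : seq 'X_{1..n}),
    [/\ size xs = r.+1 /\ size ys = r.+1,
        all (fun m => m \in edge_mnms e) xs, all (fun m => m \in edge_mnms e) ys,
        (\sum_(m <- xs) m = \sum_(m <- ys) m)%MM
      & forall m, m \in xs -> m \notin ys].
Proof.
case: w => [[[]]//|x0 l] [[_ cyc]]; set w := x0 :: l.
have szE : size (walk_edges w) = size w.
  by rewrite /walk_edges size_map size_zip size_rot minnn.
rewrite szE => ev irr.
(* Repeating the start at the end makes edge [i] join [g i] to [g i.+1] even for the closing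
   edge. *)
pose g i := nth x0 (rcons w x0) i.
have eg i : (i < size w)%N -> e (g i) (g i.+1).
  move=> lt_i; move: cyc; rewrite /= => /(pathP x0)/(_ i); rewrite size_rcons.
  by move=> /(_ lt_i); rewrite /g /= -[x0 :: rcons l x0]/(rcons w x0).
have edgeE i : (i < size w)%N -> nth set0 (walk_edges w) i = [set g i; g i.+1].
  move=> lt_i; rewrite (nth_map (x0, x0)) ?size_zip ?size_rot ?minnn //.
  rewrite nth_zip ?size_rot //= /g rot1_cons.
  by rewrite [in RHS]nth_rcons lt_i.
pose s := (size w)./2.
have sE : size w = s.*2 by rewrite -[LHS]odd_double_half (negbTE ev).
pose h i := (U_(g i) + U_(g i.+1))%MM.
have eh i : (i < size w)%N -> h i \in edge_mnms e.
  by move=> /eg egi; apply/edge_mnmsP; exists (g i), (g i.+1).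
have lt0 i : (i < s)%N -> (i.*2 < size w)%N by rewrite sE ltn_double.
have lt1 i : (i < s)%N -> (i.*2.+1 < size w)%N by rewrite sE ltn_Sdouble.
have s_gt0 : (0 < s)%N by rewrite -double_gt0 -sE.
exists s.-1, [seq h i.*2 | i <- iota 0 s], [seq h i.*2.+1 | i <- iota 0 s].
rewrite !size_map !size_iota prednK //; split=> //.
- by apply/allP=> _ /mapP[i + ->]; rewrite mem_iota => /lt0/eh.
- by apply/allP=> _ /mapP[i + ->]; rewrite mem_iota => /lt1/eh.
(* The vertices at odd positions contribute equally. Those at even positions run over [0, 2, ...] on
   the left and [2, 4, ..., s.*2] on the right, and [g s.*2 = g 0]. *)
- rewrite !big_map !big_split /= [RHS]Monoid.mulmC; congr (_ + _)%MM.
  have gs : g s.*2 = g 0%N by rewrite -sE /g nth_rcons ltnn eqxx.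
  rewrite -{1 2}(prednK s_gt0) -[iota _ _]/(index_iota 0 s.-1.+1).
  rewrite big_nat_recl // [RHS]big_nat_recr //= Monoid.mulmC; congr (_ + _)%MM.
  by rewrite -doubleS prednK // gs.
move=> _ /mapP[i + ->]; rewrite mem_iota => /lt0 lti; apply/mapP=> -[j].
rewrite mem_iota => /lt1 ltj eh_ij; apply: irr; exists i.*2, j.*2.+1.
by rewrite szE /= !odd_double !edgeE // (mnm_edge_set eh_ij).
Qed.

End Walks.

(** * The core of the edge ideal *)

Theorem theorem4p1 (k : fieldType) (k_inf : infinite_type k)
    (n : nat) (e : rel 'I_n) (e_simple : simple_graph e)
    (e_conn : connected_graph e)
    (e_walk : exists w : seq 'I_n, even_closed_walk e w /\ ~ reducible_walk w) :
  ideal_sub (core (edge_ideal k e))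
            (ideal_mul (max_ideal k n) (edge_ideal k e)).
Proof.
move=> f core_f.
have If : edge_ideal k e f.
  by apply: core_f; apply: reduction_refl; apply: ideal_gen_ideal.
have [p [q [q0 qf sp]]] := edge_ideal_den If.
have [v vq] := to_polyloc_unit q0.
have -> : f = v * to_polyloc p by rewrite -qf mulrA vq mul1r.
apply: (idealMl (ideal_mul_ideal _ _)); apply: max_edge_ideal_poly => //.
move=> m0 em0; apply/eqP; apply: contraT => pm0.
have [w [ew irr]] := e_walk.
have [r [xs [ys [[sx sy] ex ey exy disj]]]] := walk_binomial ew irr.
wlog my0 : xs ys sx sy ex ey exy disj / m0 \notin ys.
  move=> IH; have [m0y|m0y] := boolP (m0 \in ys); last exact: (IH xs ys).
  apply: (IH ys xs) => //; first by move=> m my; apply/negP => /disj; rewrite my.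
  by apply/negP => /disj; rewrite m0y.
have [a [a0 aE aP]] :=
  generic_weight (c := fun m => p@_m) k_inf (undup_uniq _) em0 my0 pm0.
(* The nonzero sum in [aP] is [edge_form a p], so it is enough to show that [f] is annihilated. *)
case/eqP: aP; apply: (edge_annihilator_form q0 qf sp).
pose X (m : 'X_{1..n}) : polyloc k n := to_polyloc 'X_[m].
pose c (m : 'X_{1..n}) : polyloc k n := to_polyloc (a m)%:MP.
(* Once the pencil is a reduction it contains [f], and an ideal containing its generators, here the
   annihilator, contains [f] too. *)
apply: (core_f (pencil_ideal (fun m => m \in edge_mnms e) X m0 c)); last first.
- move=> _ [m em ->]; rewrite -rmorphM -rmorphB -mulNr -mpolyCN.
  apply: edge_annihilator_poly.
    by apply: edge_suppD; [|apply: edge_suppM]; apply: edge_suppX.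
  rewrite edge_formD edge_formM ?edge_formX //; last exact: edge_suppX.
  by rewrite mcoeffC eqxx mulr1 a0 mulr1 subrr.
- exact: edge_annihilator_ideal.
rewrite edge_idealE.
have prodX s : \prod_(m <- s) X m = to_polyloc 'X_[\sum_(m <- s) m].
  by rewrite -mpolyX_prod rmorph_prod.
have prodc s : \prod_(m <- s) c m = to_polyloc (\prod_(m <- s) a m)%:MP.
  by rewrite !rmorph_prod.
apply: (pencil_reduction em0 (b := to_polyloc (\prod_(m <- xs) a m)^-1%:MP)
          sx sy ex ey).
- by rewrite !prodX exy.
- rewrite prodc -rmorphM -mpolyCM mulVf ?rmorph1 // prodf_seq_neq0.
  by apply/allP=> m /disj my /=; rewrite aE.
- rewrite prodc (_ : \prod_(m <- ys) a m = 0) ?rmorph0 //.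
  (* [ys] has [r.+1] entries, so it is not empty and its first entry supplies a zero factor. *)
  have y0 : nth m0 ys 0 \in ys by rewrite mem_nth ?sy.
  apply/eqP; rewrite prodf_seq_eq0; apply/hasP.
  by exists (nth m0 ys 0); rewrite //= aE.
Qed.
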